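(* Let $d\ge 0$ and $l\ge 1$ be integers, let $\alpha_1,\dots,\alpha_d\in\mathbb{C}$, $\rho\in\mathbb{C}\setminus\{0\}$, and let $R(H)=\rho\prod_{j=1}^{d}(H+\alpha_j+1)$, where $H=x\partial_x$. Let $G=R(H)\partial_x$, $\eta=l^{d+1}\rho$, $\alpha_{d+1}=0$, and for $n\ge 0$ let $P_n(x)=e^{G^l}x^n$. Then for every $n\ge 0$ (and $x\neq 0$) $$P_n(x)=x^n\;{}_{dl+l}F_{0}\left[\begin{matrix}\Delta(l;-n-\alpha_1),\dots,\Delta(l;-n-\alpha_d),\Delta(l;-n-\alpha_{d+1})\\ -\end{matrix};\left(\frac{(-1)^{d+1}\eta}{x}\right)^{l}\right].$$
   Context: $H=x\partial_x$ and $G=R(H)\partial_x$ act as differential operators on $\mathbb{C}[x]$. For a polynomial $q$ without constant term, $e^{q(G)}x^n=\sum_{j\ge0}\frac{q(G)^jx^n}{j!}$, a finite sum because $G$ lowers the degree. Pochhammer symbol: $(a)_0=1$, $(a)_j=a(a+1)\cdots(a+j-1)$. $\Delta(l;\lambda)$ denotes the list of $l$ parameters $\frac{\lambda}{l},\frac{\lambda+1}{l},\dots,\frac{\lambda+l-1}{l}$. The generalized hypergeometric series is $${}_pF_q\left[\begin{matrix}a_1,\dots,a_p\\ b_1,\dots,b_q\end{matrix};z\right]=\sum_{j\ge0}\frac{(a_1)_j\cdots(a_p)_j}{(b_1)_j\cdots(b_q)_j}\frac{z^j}{j!},$$ with ''$-$'' denoting an empty parameter list. Here the series terminates because one element of $\Delta(l;-n)$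 is a non-positive integer. *)

(* Defs.v *)
From mathcomp Require Import all_boot all_order all_algebra.
From mathcomp Require Import complex.
From mathcomp Require Import boolp classical_sets functions cardinality fsbigop.
From mathcomp Require Import reals topology normedtype sequences.

Set Implicit Arguments.
Unset Strict Implicit.
Unset Printing Implicit Defensive.

Import Order.TTheory GRing.Theory Num.Theory.
Import numFieldNormedType.Exports.

Local Open Scope classical_set_scope.
Local Open Scope ring_scope.

Section Operators.
Variable C : numFieldType.
Implicit Types (T : {poly C} -> {poly C}) (p q : {poly C}).

Definition euler_op p : {poly C} := 'X * p^`().

(* q(T), where the powers of the operator T are its iterates. *)
Definition op_eval q T p : {poly C} := \sum_(i < size q) q`_i *: iter i T p.

(* e^T p, for T locally nilpotent. The sum over nat is the finite-support sum:
   it would be 0 if infinitely many terms were nonzero, which does not happen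
   for powers of a degree-lowering T. *)
Definition exp_op T p : {poly C} :=
  \sum_(j \in [set: nat]) (j`!%:R^-1 *: iter j T p).

Definition Rpoly (rho : C) (alpha : seq C) : {poly C} :=
  rho *: \prod_(a <- alpha) ('X + (a + 1)%:P).

Definition G_op (rho : C) (alpha : seq C) p : {poly C} :=
  op_eval (Rpoly rho alpha) euler_op p^`().

Definition Ppoly (rho : C) (alpha : seq C) (l n : nat) : {poly C} :=
  exp_op (op_eval 'X^l (G_op rho alpha)) 'X^n.

End Operators.

Section Hypergeometric.
Variable C : numFieldType.

Definition pochhammer (a : C) (j : nat) : C := \prod_(i < j) (a + i%:R).

Definition Delta (l : nat) (lambda : C) : seq C :=
  [seq (lambda + i%:R) / l%:R | i <- iota 0 l].

Definition hypergeometric_term (a b : seq C) (z : C) (j : nat) : C :=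
  (\prod_(s <- a) pochhammer s j) / (\prod_(s <- b) pochhammer s j)
    * (z ^+ j / j`!%:R).

(* Limit of the partial sums; p and q are the lengths of the lists a and b. *)
Definition hypergeometric (a b : seq C) (z : C) : C :=
  limn (series (hypergeometric_term a b z)).

End Hypergeometric.

(* Main.v *)
Require Import Defs.
From mathcomp Require Import all_boot all_order all_algebra.
From mathcomp Require Import complex reals.
From mathcomp Require Import classical_sets fsbigop.
From mathcomp Require Import topology normedtype sequences.
From mathcomp Require Import ring.

Import GRing.Theory Num.Theory.
Import numFieldNormedType.Exports.
Local Open Scope ring_scope.

(** Up to a scalar, G sends each monomial to the one below it: since x^n is an
    eigenvector of H with eigenvalue n,
      G x^n = rho n (n + alpha_1) ... (n + alpha_d) x^(n-1).
    Put alpha_(d+1) = 0, so that n itself is one more factor n + alpha_(d+1),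
    and write each factor as - (- n - alpha_i).  Iterating then lets each of
    these grow into a Pochhammer symbol ([iter_G_op_Xn]):
      G^m x^n = ((-1)^(d+1) rho)^m prod_i (- n - alpha_i)_m x^(n-m).
    The factor (- n)_m kills everything beyond m = n, so both e^(G^l) x^n and
    the hypergeometric series are finite sums, and they can be compared
    term by term with m = l j.  The comparison is Gauss's multiplication formula
      (lambda)_(l j) = l^(l j) prod_(s in Delta(l; lambda)) (s)_j
    ([pochhammer_Delta]): applied to the d + 1 parameters - n - alpha_i, it
    produces the power l^((d+1) l j), which turns rho into eta. *)

(** * Pochhammer symbols *)

Lemma prodrN_seq (A : comPzRingType) (I : Type) (r : seq I) (F : I -> A) :
  \prod_(i <- r) - F i = (-1) ^+ size r * \prod_(i <- r) F i.
Proof.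
elim: r => [|i r IHr]; first by rewrite !big_nil mulr1.
rewrite !big_cons IHr exprS; ring.
Qed.

Section Pochhammer.
Variable C : numFieldType.
Implicit Types (a lambda : C).

Lemma pochhammerS a j : pochhammer a j.+1 = pochhammer a j * (a + j%:R).
Proof. by rewrite /pochhammer big_ord_recr. Qed.

Lemma pochhammerD a m k :
  pochhammer a (m + k) = pochhammer a m * \prod_(i < k) (a + (m + i)%:R).
Proof. by rewrite /pochhammer big_split_ord. Qed.

Lemma pochhammer_oppn_eq0 n m : (n < m)%N -> pochhammer (- n%:R : C) m = 0.
Proof.
move=> ltnm; rewrite /pochhammer (bigD1 (Ordinal ltnm)) //=.
by rewrite addNr mul0r.
Qed.

(** The parameter - n - alpha_(d+1) = - n makes the product vanish; this is what
    stops both the exponential and the hypergeometric series. *)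
Lemma prod_pochhammer_eq0 (alpha : seq C) n m : (n < m)%N ->
  \prod_(a <- rcons alpha 0) pochhammer (- n%:R - a) m = 0.
Proof.
move=> ltnm; rewrite big_rcons /= subr0.
by rewrite pochhammer_oppn_eq0 // !(mulr0, mul0r).
Qed.

(** Gauss's multiplication formula: the numbers below l (j + 1) are those below
    l j followed by l j + i for i < l, and lambda + l j + i is l times the last
    factor of (s)_(j+1) for the element s = (lambda + i) / l of the list. *)
Lemma pochhammer_Delta l lambda j : (0 < l)%N ->
  pochhammer lambda (l * j) =
  l%:R ^+ (l * j) * \prod_(s <- Delta l lambda) pochhammer s j.
Proof.
move=> l_gt0; have l0 : l%:R != 0 :> C by rewrite pnatr_eq0 -lt0n.
rewrite /Delta big_map (_ : iota 0 l = index_iota 0 l) ?big_mkord; last first.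
  by rewrite /index_iota subn0.
elim: j => [|j IHj].
  by rewrite muln0 /pochhammer big_ord0 mul1r big1 // => i _; rewrite big_ord0.
rewrite mulnS addnC pochhammerD IHj.
rewrite (eq_bigr _ (fun i _ => pochhammerS _ j)) big_split /=.
rewrite exprD -!mulrA; congr (_ * _); rewrite mulrCA; congr (_ * _).
rewrite -[in l%:R ^+ l](card_ord l) -prodr_const -big_split /=.
apply: eq_bigr => i _; rewrite card_ord natrD natrM.
by field.
Qed.

End Pochhammer.

(** * The operator G on monomials *)

Section Monomials.
Variable C : numFieldType.
Implicit Types (T : {poly C} -> {poly C}) (p q v : {poly C}) (c rho : C).

(** The hypothesis asks for T to act by the scalar c on the whole line spanned
    by v, so that every iterate of T is governed by it without T being linear. *)
Lemma op_eval_eigen q T v c : (forall b, T (b *: v) = (b * c) *: v) ->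
  op_eval q T v = q.[c] *: v.
Proof.
move=> Tv; rewrite /op_eval horner_coef scaler_suml.
apply: eq_bigr => i _; rewrite -scalerA; congr (_ *: _).
elim: (nat_of_ord i) => [|k IHk] /=; first by rewrite expr0 scale1r.
by rewrite IHk Tv exprSr.
Qed.

Lemma op_eval_Xn k T v : op_eval 'X^k T v = iter k T v.
Proof.
rewrite /op_eval size_polyXn big_ord_recr /= coefXn eqxx scale1r.
rewrite big1 ?add0r // => i _.
by rewrite coefXn (ltn_eqF (ltn_ord i)) scale0r.
Qed.

Lemma iter_op_eval_Xn k T j v :
  iter j (op_eval 'X^k T) v = iter (k * j) T v.
Proof.
elim: j => [|j IHj]; first by rewrite muln0.
by rewrite iterS IHj op_eval_Xn mulnS iterD.
Qed.

Lemma euler_op_Xn c n : euler_op (c *: 'X^n) = (c * n%:R) *: 'X^n.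
Proof.
rewrite /euler_op derivZ derivXn -scalerAr -scalerA scaler_nat mulrnAr.
by case: n => [|n]; rewrite ?mulr0n // -exprS.
Qed.

Lemma horner_Rpoly rho (alpha : seq C) (t : C) :
  (Rpoly rho alpha).[t] = rho * \prod_(a <- alpha) (t + (a + 1)).
Proof.
rewrite /Rpoly hornerZ horner_prod; congr (_ * _).
by apply: eq_bigr => a _; rewrite hornerD hornerX hornerC.
Qed.

Lemma op_eval_euler_Xn q c n :
  op_eval q (@euler_op C) (c *: 'X^n) = (c * q.[n%:R]) *: 'X^n.
Proof.
rewrite (op_eval_eigen q _ _ n%:R) => [|b]; first by rewrite scalerA mulrC.
by rewrite !scalerA euler_op_Xn mulrAC.
Qed.

(** The derivative contributes the factor n = n + 0, which is why 0 joins
    the list of the alpha_j.  At n = 0 that factor makes both sides vanish. *)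
Lemma G_op_Xn rho (alpha : seq C) c n :
  G_op rho alpha (c *: 'X^n) =
  (c * rho * \prod_(a <- rcons alpha 0) (n%:R + a)) *: 'X^(n.-1).
Proof.
rewrite /G_op derivZ derivXn -scaler_nat scalerA op_eval_euler_Xn.
congr (_ *: _); rewrite big_rcons /= addr0 horner_Rpoly.
case: n => [|n]; first by rewrite !(mulr0, mul0r).
rewrite [in RHS](eq_bigr (fun a => n%:R + (a + 1))) /=; first by ring.
by move=> a _; rewrite -natr1 -addrA [1 + a]addrC.
Qed.

(** For m > n the exponent n - m is truncated to 0, which is harmless: the
    coefficient contains (- n)_m = 0.  The factors n - m + alpha_i picked up at
    step m are - (- n - alpha_i + m), hence the sign (-1)^(d+1) at each step. *)
Lemma iter_G_op_Xn rho (alpha : seq C) n m :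
  iter m (G_op rho alpha) 'X^n =
  (((-1) ^+ (size alpha).+1 * rho) ^+ m
    * \prod_(a <- rcons alpha 0) pochhammer (- n%:R - a) m) *: 'X^(n - m).
Proof.
elim: m => [|m IHm].
  rewrite subn0 expr0 mul1r big1 ?scale1r // => a _.
  by rewrite /pochhammer big_ord0.
rewrite iterS IHm G_op_Xn -subnS.
have [lemn|ltnm] := leqP m n; last first.
  by rewrite !prod_pochhammer_eq0 ?(leqW ltnm) // !(mulr0, mul0r).
congr (_ *: _).
rewrite (eq_bigr _ (fun a _ => pochhammerS _ (- n%:R - a) m)) big_split /=.
rewrite natrB //.
have -> : \prod_(a <- rcons alpha 0) (n%:R - m%:R + a) =
    (-1) ^+ (size alpha).+1 * \prod_(a <- rcons alpha 0) (- n%:R - a + m%:R).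
  rewrite -(size_rcons alpha 0) -prodrN_seq.
  by apply: eq_bigr => a _; ring.
rewrite [_ ^+ m.+1]exprSr; ring.
Qed.

End Monomials.

(** * Finite sums *)

Section FiniteSums.
Variable C : numFieldType.

Lemma exp_op_finite (T : {poly C} -> {poly C}) v N :
  (forall j, (N <= j)%N -> iter j T v = 0) ->
  exp_op T v = \sum_(j < N) (j`!%:R^-1 *: iter j T v).
Proof.
move=> T0; rewrite /exp_op (fsbig_ord _ _ (fun j => j`!%:R^-1 *: iter j T v)).
apply/esym/fsbig_widen => // j [_ /= /negP]; rewrite -leqNgt => leNj.
by rewrite T0 ?scaler0.
Qed.

Lemma hypergeometric_finite (a b : seq C) z N :
  (forall j, (N <= j)%N -> hypergeometric_term a b z j = 0) ->
  hypergeometric a b z = \sum_(j < N) hypergeometric_term a b z j.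
Proof.
move=> t0; rewrite /hypergeometric; apply: lim_near_cst => //.
exists N => // m /= leNm.
rewrite /series /= (big_cat_nat _ leNm) //= big_mkord.
rewrite [X in _ + X]big_nat_cond [X in _ + X]big1 ?addr0 //.
by move=> j /andP[/andP[leNj _] _]; rewrite t0.
Qed.

End FiniteSums.

(** * Comparison of the exponential and the hypergeometric series *)

Section Expansion.
Variable C : numFieldType.

Lemma pochhammer_flatten_Delta (l j : nat) (s : seq C) : (0 < l)%N ->
  \prod_(b <- s) pochhammer b (l * j) =
  l%:R ^+ (size s * (l * j))
    * \prod_(t <- flatten [seq Delta l b | b <- s]) pochhammer t j.
Proof.
move=> l_gt0; rewrite big_flatten big_map.
rewrite (eq_bigr _ (fun b _ => pochhammer_Delta _ _ b j l_gt0)) big_split /=.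
by rewrite big_const_seq count_predT iter_mulr_1 -exprM mulnC.
Qed.

Section Terms.
Variables (alpha : seq C) (rho : C) (l n : nat) (x : C).
Hypotheses (l_gt0 : (0 < l)%N) (x_neq0 : x != 0).

Let params : seq C :=
  flatten [seq Delta l (- n%:R - a) | a <- rcons alpha 0].
Let D : nat := (size alpha).+1.
Let z : C := ((-1) ^+ D * (l%:R ^+ D * rho) / x) ^+ l.

(** The power of l is what separates eta^(l j) from rho^(l j), since
    eta = l^(d+1) rho. *)
Lemma pochhammer_params j :
  \prod_(a <- rcons alpha 0) pochhammer (- n%:R - a) (l * j) =
  l%:R ^+ (D * (l * j)) * \prod_(t <- params) pochhammer t j.
Proof.
rewrite -(big_map (fun a => - n%:R - a) predT (fun b => pochhammer b (l * j))).
rewrite pochhammer_flatten_Delta // size_map size_rcons.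
by rewrite -map_comp.
Qed.

Lemma pochhammer_params_eq0 j : (n < l * j)%N ->
  \prod_(t <- params) pochhammer t j = 0.
Proof.
move=> ltn; have l0 : l%:R != 0 :> C by rewrite pnatr_eq0 -lt0n.
apply: (mulfI (expf_neq0 (D * (l * j)) l0)).
by rewrite -pochhammer_params prod_pochhammer_eq0 // mulr0.
Qed.

Lemma exp_term_hypergeometric_term j :
  (j`!%:R^-1 *: iter j (op_eval 'X^l (G_op rho alpha)) 'X^n).[x] =
  x ^+ n * hypergeometric_term params [::] z j.
Proof.
rewrite iter_op_eval_Xn iter_G_op_Xn pochhammer_params /hypergeometric_term.
rewrite big_nil divr1 !hornerZ hornerXn -/D.
(* Beyond degree n the exponent n - l j no longer matches x^n / x^(l j), but
   both sides vanish. *)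
have [lejn|ltnj] := leqP (l * j) n; last first.
  by rewrite pochhammer_params_eq0 // !(mulr0, mul0r).
rewrite /z -[in x ^+ n](subnK lejn) exprD -exprM expr_div_n !exprMn.
rewrite -[(l%:R ^+ D) ^+ _]exprM.
have xM0 : x ^+ (l * j) != 0 by rewrite expf_neq0.
have f0 : j`!%:R != 0 :> C by rewrite pnatr_eq0 -lt0n fact_gt0.
by field; rewrite f0 xM0.
Qed.

Lemma Ppoly_hypergeometric :
  (Ppoly rho alpha l n).[x] = x ^+ n * hypergeometric params [::] z.
Proof.
have ltnM j : (n < j)%N -> (n < l * j)%N.
  by move=> ltnj; apply: leq_trans ltnj _; rewrite leq_pmull.
rewrite (hypergeometric_finite _ _ _ _ n.+1) => [|j /ltnM ltnj]; last first.
  by rewrite /hypergeometric_term pochhammer_params_eq0 ?mul0r.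
rewrite /Ppoly (exp_op_finite _ _ _ n.+1) => [|j /ltnM ltnj]; last first.
  rewrite iter_op_eval_Xn iter_G_op_Xn pochhammer_params.
  by rewrite pochhammer_params_eq0 // !mulr0 scale0r.
rewrite horner_sum mulr_sumr; apply: eq_bigr => j _.
exact: exp_term_hypergeometric_term.
Qed.

End Terms.
End Expansion.

Theorem theorem3p3 (R : realType) (d l : nat) (alpha : d.-tuple R[i])
    (rho : R[i]) (hl : (1 <= l)%N) (hrho : rho != 0) :
  let eta : R[i] := l%:R ^+ d.+1 * rho in
  forall (n : nat) (x : R[i]), x != 0 ->
    (Ppoly rho alpha l n).[x] =
    x ^+ n * hypergeometric
               (flatten [seq Delta l (- n%:R - a) | a <- rcons alpha 0]) [::]
               (((-1) ^+ d.+1 * eta / x) ^+ l).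
Proof.
move=> eta n x x0.
have := Ppoly_hypergeometric R[i] alpha rho l n x hl x0.
by rewrite size_tuple.
Qed.
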